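(* Let $(X,\|\cdot\|)$ be a Banach space, $C\subseteq X$ a closed convex set, and $T:C\to C$ a nonexpansive map. Let $(\alpha_n)_{n\ge 1}$ be a sequence in $[0,1]$, $(e_n)_{n\ge 1}$ a sequence in $X$, and $(\epsilon_n)_{n\geq 1}$ real numbers with $\epsilon_n\ge\|e_n\|$ for all $n\ge 1$. Let $x_0\in C$ and let $(x_n)_{n\in\mathbb{N}}$ be generated by $$x_{n+1}=(1-\alpha_{n+1})\,x_n+\alpha_{n+1}\,(Tx_n+e_{n+1}),\qquad n\in\mathbb{N}.$$ Assume that there exists $\kappa\in[0,\infty)$ such that $x_n\in C$ and $\|Tx_n-x_0\|\le\kappa$ for all $n\in\mathbb{N}$. Then, for all $n\in\mathbb{N}$, $$\|x_n-Tx_n\|\le \kappa\,\sigma(\tau_n)+\sum_{i=1}^{n}2\,\alpha_i\epsilon_i\,\sigma(\tau_n-\tau_i)+2\,\epsilon_{n+1}.$$ In particular, if $\tau_n\to\infty$ and $\epsilon_n\to 0$ with $\sum_{k\ge1}\alpha_k\epsilon_k<\infty$, then $\|x_n-Tx_n\|\to0$.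
   Context: $\mathbb{N}=\{0,1,2,\dots\}$. $T$ nonexpansive means $\|Tx-Ty\|\le\|x-y\|$ for all $x,y$ in its domain. $\tau_n=\sum_{k=1}^n\alpha_k(1-\alpha_k)$ (so $\tau_0=0$). The function $\sigma:[0,\infty)\to\mathbb{R}$ is $\sigma(y)=\min\{1,1/\sqrt{\pi y}\}$, with $\sigma(0)=1$. *)

(* Defs.v *)
From HB Require Import structures.
From mathcomp Require Export all_boot all_order all_algebra.
From mathcomp Require Export all_classical all_reals all_analysis.

Set Implicit Arguments.
Unset Strict Implicit.
Unset Printing Implicit Defensive.

Import Order.TTheory GRing.Theory Num.Theory.
Import numFieldNormedType.Exports.

Local Open Scope classical_set_scope.
Local Open Scope ring_scope.

(* Only [0, +oo) matters. The value at 0 is set separately because 0^-1 = 0,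
   so that the bare minimum would be 0 there instead of 1. *)
Definition sigma (R : realType) (y : R) : R :=
  if y == 0 then 1 else Num.min 1 (1 / Num.sqrt (pi * y)).

(* The sequence alpha starts at index 1; alpha 0 is never used. *)
Definition tau (R : realType) (alpha : nat -> R) (n : nat) : R :=
  \sum_(1 <= k < n.+1) alpha k * (1 - alpha k).

(* Main.v *)
Require Import Defs.
From mathcomp Require Import zify ring lra.
From mathcomp Require Import measurable_realfun gauss_integral.

(** The distances between the points x_m, x_k and T x_k with m <= k are
    controlled by a pursuit. A hare starts from m and a fox from k; both run
    down to 0, and on arriving at an index j each one independently jumps over
    it with probability 1 - alpha_j, or falls there with probability alpha_j.
    This reads off the expansion
      x_j = (1 - alpha_j) x_{j-1} + alpha_j (T x_{j-1} + e_j),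
    where a fall produces a T; when both points carry a T, nonexpansiveness
    removes the two. The fox catches the hare when both are at the same x_m,
    which contributes the distance 0, and the hare escapes on reaching x_0,
    which contributes at most kappa, because it then faces some T x_k. Along
    the way each visit of an index i costs alpha_i epsilon_i.

    The hare is still free exactly as long as the fox has fallen more often
    than the hare. The difference of the two numbers of falls is a lazy walk
    which moves by +1 and by -1 with the same probability
    p_j = alpha_j (1 - alpha_j). From the pair (x_n, T x_n) it starts at 1, so
    escape has the probability [survival p n 1] that the walk stays positive.
    The index i can be visited, once by each animal, only if the walk has
    stayed positive over the indices n, ..., i+1. Hence
      |x_n - T x_n| <= kappa * P_{0,n} + sum_i 2 alpha_i epsilon_i P_{i,n},
    where P_{i,n} is the survival probability over the steps p_{i+1}, ..., p_n.
    Lemma [km_residual_bound] proves this by induction, without any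
    probability space.

    It remains to see that a survival probability is at most sigma of the sum
    S of the p_j. Lemma [survivalE] writes it as a trigonometric integral,
    which for a walk started at 1 is
      (1/pi) int_0^pi (1 + cos t) prod_j (1 - 2 p_j (1 - cos t)) dt.
    As 1 - y <= exp(-y) and 1 + cos t <= 2 cos(t/2), the
    substitution u = 2 sqrt(S) sin(t/2) bounds it by a Gaussian integral
    whose value is 1 / sqrt(pi S): lemma [survival_le].

    Convergence to 0 follows from sigma(y) -> 0 at infinity and dominated
    convergence for series, lemma [tannery]. *)

Set Implicit Arguments.
Unset Strict Implicit.
Unset Printing Implicit Defensive.

Import Order.TTheory GRing.Theory Num.Theory.
Import numFieldNormedType.Exports.

Local Open Scope classical_set_scope.
Local Open Scope ring_scope.

(** * The pursuit process *)

(** Probability that the walk started from height [s], making the steps n,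
    n-1, ..., 1, the j-th of which is +1 or -1 with probability [p j] each and
    0 otherwise, never reaches height 0. The value [p 0] is not used. *)
Fixpoint survival (R : realType) (p : nat -> R) (n s : nat) {struct n} : R :=
  match n, s with
  | _, 0 => 0
  | 0, _.+1 => 1
  | n'.+1, s'.+1 =>
      p n * survival p n' s'.+2 + (1 - 2 * p n) * survival p n' s'.+1
      + p n * survival p n' s'
  end.

(** Probability that exactly a given one of the two animals falls at [j]. *)
Definition step_prob (R : realType) (alpha : nat -> R) (j : nat) : R :=
  alpha j * (1 - alpha j).

(** Probability that a hare at [m] escapes from a fox at [m + d] which is ahead
    by [s] falls: the fox first crosses the indices m + d, ..., m + 1 alone,
    each fall raising its lead by one, then both run through m, ..., 1. *)
Fixpoint pursuit (R : realType) (alpha : nat -> R) (m d s : nat) {struct d} : R :=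
  if d is d'.+1 then
    alpha (m + d)%N * pursuit alpha m d' s.+1
    + (1 - alpha (m + d)%N) * pursuit alpha m d' s
  else survival (step_prob alpha) m s.

(** The sequence seen from [i]: index 0, which is never used, sits at [i]. *)
Definition shift_seq (R : realType) (alpha : nat -> R) (i j : nat) : R :=
  alpha (i + j)%N.

Section Pursuit.
Context {R : realType}.
Implicit Types (p alpha : nat -> R).

Lemma survival_bounds p :
  (forall j, (0 < j)%N -> 0 <= p j <= 1 / 4) ->
  forall n s, 0 <= survival p n s <= 1.
Proof.
move=> p_range; elim=> [|n IH] [|s] //=; rewrite ?lexx ?ler01 //.
have /andP[p0 p1] := p_range n.+1 isT.
have /andP[a0 a1] := IH s.+2; have /andP[b0 b1] := IH s.+1.
have /andP[c0 c1] := IH s.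
by apply/andP; split; nra.
Qed.

Lemma step_prob_range alpha :
  (forall n, (1 <= n)%N -> 0 <= alpha n <= 1) ->
  forall j, (0 < j)%N -> 0 <= step_prob alpha j <= 1 / 4.
Proof.
move=> ha j j0; have /andP[a0 a1] := ha j j0.
rewrite /step_prob; have := sqr_ge0 (alpha j - 1 / 2).
by rewrite expr2 => h; apply/andP; split; nra.
Qed.

Lemma pursuit_ge0 alpha m d s :
  (forall n, (1 <= n)%N -> 0 <= alpha n <= 1) -> 0 <= pursuit alpha m d s.
Proof.
move=> ha; elim: d s => [|d IH] s /=.
  by have /andP[] := survival_bounds (step_prob_range ha) m s.
have /andP[a0 a1] := ha (m + d.+1)%N ltac:(by rewrite addnS).
by rewrite addr_ge0 // mulr_ge0 ?IH // subr_ge0.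
Qed.

Lemma pursuit0 alpha d s : pursuit alpha 0 d s.+1 = 1.
Proof. by elim: d s => [|d IH] s //=; rewrite !IH; ring. Qed.

Lemma pursuitS alpha m d s :
  pursuit alpha m d.+1 s =
  alpha (m + d.+1)%N * pursuit alpha m d s.+1
  + (1 - alpha (m + d.+1)%N) * pursuit alpha m d s.
Proof. by []. Qed.

(** [pursuit] is defined by moving the fox; it also satisfies the recursion
    obtained by moving the hare, because the two animals are independent. *)
Lemma pursuit_hare alpha m d s :
  pursuit alpha m.+1 d s.+1 =
  (1 - alpha m.+1) * pursuit alpha m d.+1 s.+1
  + alpha m.+1 * pursuit alpha m d.+1 s.
Proof.
elim: d s => [|d IH] s.
  by rewrite /= addn1 /step_prob; ring.
by rewrite pursuitS !IH (pursuitS _ _ d.+1) (pursuitS _ _ d.+1) addSnnS; ring.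
Qed.

End Pursuit.

(** * Distances along the iteration *)

Section KrasnoselskiiMann.
Context {R : realType} {X : normedModType R}.

(** Upper bound for the expected number of visits of the index [i] by a hare at
    [m] and a fox at [m + d], for [i <= m + d]. If [i <= m], each animal visits
    [i] at most once, and only if the hare is free just before [i]; the factor
    2 counts both. If [m < i], only the fox can visit [i]. *)
Definition error_weight (alpha : nat -> R) (i m d s : nat) : R :=
  if (i <= m)%N then 2 * pursuit (shift_seq alpha i) (m - i) d s else 1.

Lemma shift_seq_range (alpha : nat -> R) i :
  (forall n, (1 <= n)%N -> 0 <= alpha n <= 1) ->
  forall n, (1 <= n)%N -> 0 <= shift_seq alpha i n <= 1.
Proof. by move=> ha n n0; apply: ha; rewrite ltn_addl. Qed.

Lemma shift_seq_subS (alpha : nat -> R) i m :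
  (i <= m)%N -> shift_seq alpha i (m - i).+1 = alpha m.+1.
Proof. by move=> im; rewrite /shift_seq addnS subnKC. Qed.

Lemma error_weight_ge0 (alpha : nat -> R) i m d s :
  (forall n, (1 <= n)%N -> 0 <= alpha n <= 1) -> 0 <= error_weight alpha i m d s.
Proof.
move=> ha; rewrite /error_weight; case: ifP => // _.
by rewrite mulr_ge0 // pursuit_ge0 //; apply: shift_seq_range.
Qed.

Lemma error_weight_fox (alpha : nat -> R) i m d s :
  error_weight alpha i m d.+1 s =
  alpha (m + d.+1)%N * error_weight alpha i m d s.+1
  + (1 - alpha (m + d.+1)%N) * error_weight alpha i m d s.
Proof.
rewrite /error_weight; case: ifPn => im; last by ring.
rewrite pursuitS {1 3}/shift_seq addnA subnKC //. by ring.
Qed.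

(** When the hare moves off [i = m.+1], the weight drops from 2 to 1: the
    difference pays for the visit of the hare. *)
Lemma error_weight_hare (alpha : nat -> R) i m d s :
  (1 - alpha m.+1) * error_weight alpha i m d.+1 s.+1
  + alpha m.+1 * error_weight alpha i m d.+1 s + (i == m.+1)%:R
  <= error_weight alpha i m.+1 d s.+1.
Proof.
rewrite /error_weight; have [im|im|->] := ltngtP i m.+1.
- rewrite -ltnS im subSn // pursuit_hare shift_seq_subS //.
  by rewrite mulr0n le_eqVlt; apply/orP; left; apply/eqP; ring.
- by rewrite leqNgt (ltnW im : m < i)%N mulr0n /=; lra.
- by rewrite ltnn subnn pursuit0 mulr1n /=; lra.
Qed.

Variables (C : set X) (T : X -> X) (alpha epsilon : nat -> R) (e x : nat -> X).
Variable kappa : R.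
Hypothesis T_nonexp : forall u v, C u -> C v -> `|T u - T v| <= `|u - v|.
Hypothesis alpha_range : forall n, (1 <= n)%N -> 0 <= alpha n <= 1.
Hypothesis e_le : forall n, (1 <= n)%N -> `|e n| <= epsilon n.
Hypothesis x_rec : forall n,
  x n.+1 = (1 - alpha n.+1) *: x n + alpha n.+1 *: (T (x n) + e n.+1).
Hypothesis kappa_ge0 : 0 <= kappa.
Hypothesis x_C : forall n, C (x n).
Hypothesis Tx_bound : forall n, `|T (x n) - x 0%N| <= kappa.

Let delta i := alpha i * epsilon i.

Let delta_ge0 i : (1 <= i)%N -> 0 <= delta i.
Proof.
move=> i1; rewrite mulr_ge0 //; first by have /andP[] := alpha_range i1.
exact: le_trans (e_le i1).
Qed.

(** Bound for the distance from [x m] to [x (m + d)] when [s = 0], and to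
    [T (x (m + d))] when [s = 1]. *)
Definition pursuit_bound m d s :=
  kappa * pursuit alpha m d s
  + \sum_(1 <= i < (m + d).+1) alpha i * epsilon i * error_weight alpha i m d s.

Lemma pursuit_bound_ge0 m d s : 0 <= pursuit_bound m d s.
Proof.
rewrite addr_ge0 ?mulr_ge0 ?pursuit_ge0 // big_nat_cond sumr_ge0 // => i.
by rewrite andbT => /andP[i1 _]; rewrite mulr_ge0 ?delta_ge0 ?error_weight_ge0.
Qed.

Lemma averaged_dist (n : nat) (z : X) :
  `|x n.+1 - z| <=
  (1 - alpha n.+1) * `|x n - z| + alpha n.+1 * `|T (x n) - z|
  + alpha n.+1 * epsilon n.+1.
Proof.
have /andP[a0 a1] := alpha_range (isT : 0 < n.+1)%N.
have -> : x n.+1 - z = (1 - alpha n.+1) *: (x n - z)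
    + alpha n.+1 *: (T (x n) - z) + alpha n.+1 *: e n.+1.
  have E : z = (1 - alpha n.+1) *: z + alpha n.+1 *: z.
    by rewrite -scalerDl subrK scale1r.
  by rewrite x_rec !scalerBr [in LHS]E scalerDr opprD addrACA [_ + _ - _]addrAC addrA.
apply: (le_trans (ler_normD _ _)); rewrite lerD //; last first.
  by rewrite normrZ ger0_norm // ler_wpM2l // e_le.
apply: (le_trans (ler_normD _ _)).
by rewrite !normrZ !ger0_norm // subr_ge0.
Qed.

Lemma pursuit_bound_fox m d :
  (1 - alpha (m + d).+1) * pursuit_bound m d 0
  + alpha (m + d).+1 * pursuit_bound m d 1 + delta (m + d).+1
  = pursuit_bound m d.+1 0.
Proof.
rewrite /pursuit_bound addnS [in RHS]big_nat_recr //= !addnS.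
have -> : error_weight alpha (m + d).+1 m d.+1 0 = 1.
  by rewrite /error_weight ltnNge leq_addr.
under [in RHS]eq_bigr do rewrite error_weight_fox addnS mulrDr mulrCA [X in _ + X]mulrCA.
rewrite big_split -!mulr_sumr /= /delta; ring.
Qed.

Lemma pursuit_bound_hare m d :
  (1 - alpha m.+1) * pursuit_bound m d.+1 1
  + alpha m.+1 * pursuit_bound m d.+1 0 + delta m.+1
  <= pursuit_bound m.+1 d 1.
Proof.
rewrite /pursuit_bound pursuit_hare addnS addSn.
set S1 := \sum_(_ <= _ < _) _; set S0 := \sum_(_ <= _ < _) _.
set S := \sum_(_ <= _ < _) _.
suff : (1 - alpha m.+1) * S1 + alpha m.+1 * S0 + delta m.+1 <= S by nra.
have -> : delta m.+1 = \sum_(1 <= i < (m + d).+2) delta i * (i == m.+1)%:R.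
  rewrite (bigD1_seq m.+1) ?iota_uniq ?mem_index_iota //=; last first.
    by rewrite !ltnS leq_addr.
  by rewrite eqxx mulr1 big1 ?addr0 // => i /negbTE ->; rewrite mulr0.
rewrite /S1 /S0 /S !mulr_sumr -!big_split /= big_nat_cond [leRHS]big_nat_cond.
apply: ler_sum => i /andP[/andP[i1 _] _].
rewrite (mulrCA (1 - _)) (mulrCA (alpha m.+1)) -!mulrDr.
by rewrite ler_wpM2l ?delta_ge0 // error_weight_hare.
Qed.

(** Expanding the larger index of a pair [x m], [x k] leads to pairs with index
    [k - 1]; expanding [x m] against [T (x k)] leads to pairs with index
    [m - 1]. Both decrease m + k = m + m + d, the induction measure. *)
Lemma dist_le_pursuit_bound N : forall m d, (m + m + d <= N)%N ->
  `|x m - x (m + d)%N| <= pursuit_bound m d 0 /\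
  `|x m - T (x (m + d)%N)| <= pursuit_bound m d 1.
Proof.
(* The distance bound at (m, d) follows from both bounds at (m, d - 1): the fox
   moves first. For d = 0 the distance is 0. *)
have fox_moves m d : (forall d', d = d'.+1 ->
    `|x m - x (m + d')%N| <= pursuit_bound m d' 0 /\
    `|x m - T (x (m + d')%N)| <= pursuit_bound m d' 1) ->
    `|x m - x (m + d)%N| <= pursuit_bound m d 0.
  case: d => [_|d /(_ d erefl)[hx hT]].
    by rewrite addn0 subrr normr0 pursuit_bound_ge0.
  have /andP[a0 a1] := alpha_range (isT : 0 < (m + d).+1)%N.
  rewrite addnS distrC (le_trans (averaged_dist _ _)) // -pursuit_bound_fox.
  by rewrite lerD2r lerD // ler_wpM2l // ?subr_ge0 // distrC.
elim: N => [|N IH] m d mdN.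
  move: mdN; rewrite leqn0 !addn_eq0 => /andP[/andP[/eqP-> _] /eqP->].
  split; first by apply: fox_moves.
  by rewrite /pursuit_bound big_geq // addr0 pursuit0 mulr1 distrC.
split; first by apply: fox_moves => d' dd'; apply: IH; rewrite dd' addnS in mdN.
case: m mdN => [_|m mdN].
  rewrite distrC (le_trans (Tx_bound _)) // /pursuit_bound pursuit0 mulr1 lerDl.
  rewrite big_nat_cond sumr_ge0 // => i.
  by rewrite andbT => /andP[i1 _]; rewrite mulr_ge0 ?delta_ge0 ?error_weight_ge0.
have [hx hT] : `|x m - x (m + d.+1)%N| <= pursuit_bound m d.+1 0 /\
  `|x m - T (x (m + d.+1)%N)| <= pursuit_bound m d.+1 1 by apply: IH; lia.
have /andP[a0 a1] := alpha_range (isT : 0 < m.+1)%N.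
rewrite (le_trans (averaged_dist _ _)) // addSnnS.
apply: le_trans (pursuit_bound_hare _ _).
rewrite lerD2r lerD // ler_wpM2l ?subr_ge0 //.
by apply: le_trans hx; apply: T_nonexp.
Qed.

Lemma km_residual_bound n :
  `|x n - T (x n)| <= kappa * survival (step_prob alpha) n 1
  + \sum_(1 <= i < n.+1) 2 * alpha i * epsilon i
      * survival (step_prob (shift_seq alpha i)) (n - i) 1.
Proof.
have [_] := dist_le_pursuit_bound (leqnn (n + n + 0)).
rewrite /pursuit_bound addn0 => /le_trans; apply; rewrite lerD2l.
apply: ler_sum_nat => i /andP[_]; rewrite ltnS => i_n.
rewrite /error_weight i_n le_eqVlt; apply/orP; left; apply/eqP => /=; ring.
Qed.

End KrasnoselskiiMann.

(** * Fourier representation of the survival probability *)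

Section Integral.
Context {R : realType}.
Notation mu := (@lebesgue_measure R).
Implicit Types (f g : R -> R) (p : nat -> R).

(** Mean value over the interval from 0 to pi. *)
Definition pi_mean f : R := pi^-1 * \int[mu]_(t in `[0, pi]) f t.

Lemma integrable_0pi f :
  continuous f -> mu.-integrable `[0, pi] (EFin \o f).
Proof.
move=> cf; apply: continuous_compact_integrable; first exact: segment_compact.
by apply: continuous_subspaceT => x; exact: cf.
Qed.

Lemma pi_meanD f g : continuous f -> continuous g ->
  pi_mean (fun t => f t + g t) = pi_mean f + pi_mean g.
Proof.
by move=> cf cg; rewrite /pi_mean RintegralD ?mulrDr //; exact: integrable_0pi.
Qed.

Lemma pi_meanZ (c : R) f : continuous f ->
  pi_mean (fun t => c * f t) = c * pi_mean f.
Proof.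
move=> cf; rewrite /pi_mean RintegralZl 1?mulrCA //; exact: integrable_0pi.
Qed.

Lemma eq_pi_mean f g : f =1 g -> pi_mean f = pi_mean g.
Proof. by move=> fg; congr (_ * _); apply: eq_Rintegral => t _. Qed.

Lemma le_pi_mean f g : continuous f -> continuous g ->
  (forall t, 0 <= t <= pi -> f t <= g t) -> pi_mean f <= pi_mean g.
Proof.
move=> cf cg fg; rewrite /pi_mean ler_wpM2l ?invr_ge0 ?pi_ge0 //.
apply: le_Rintegral => //; try exact: integrable_0pi.
Qed.

Lemma pi_mean1 : pi_mean (fun=> 1) = 1.
Proof.
rewrite /pi_mean Rintegral_cst //= lebesgue_measure_itv /= lte_fin pi_gt0 /=.
by rewrite mul1r subr0 mulVf // gt_eqF // pi_gt0.
Qed.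

Lemma sin_natpi j : sin (j%:R * pi) = 0 :> R.
Proof.
by elim: j => [|j IH]; rewrite ?mul0r ?sin0 // -natr1 mulrDl mul1r sinDpi IH oppr0.
Qed.

Lemma continuous_cosM (a : R) : continuous (fun t => cos (a * t)).
Proof.
move=> t; apply: (@continuous_comp _ _ _ (fun t => a * t) (@cos R)).
  exact: mulrl_continuous.
exact: continuous_cos.
Qed.

Lemma pi_mean_cos j : (0 < j)%N -> pi_mean (fun t => cos (j%:R * t)) = 0.
Proof.
move=> j0; have jn0 : j%:R != 0 :> R by rewrite pnatr_eq0 -lt0n.
pose F (t : R) := j%:R^-1 * sin (j%:R * t).
have dF (t : R) : is_derive t 1 F (cos (j%:R * t)).
  apply: is_derive_eq.
  by rewrite /GRing.scale /=; field.
rewrite /pi_mean /Rintegral.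
rewrite (@continuous_FTC2 R _ F 0 pi) ?pi_gt0 //=.
- by rewrite /F sin_natpi !mulr0 sin0 mulr0 subrr mulr0.
- by apply: continuous_subspaceT => x; exact: continuous_cosM.
- have cF : continuous F.
    move=> t; apply: differentiable_continuous; apply/derivable1_diffP.
    exact: ex_derive.
  split => [t _||]; first exact: ex_derive.
  + by apply: cvg_at_right_filter; exact: cF.
  + by apply: cvg_at_left_filter; exact: cF.
- by move=> t _; rewrite derive1E derive_val.
Qed.

(** Equal to sin(s t) cot(t/2), written as a trigonometric polynomial to avoid
    the division by 0. Its mean value is 1 for s > 0, and in [s] it is an
    eigenvector of the neighbour sum, with eigenvalue 2 cos t, which vanishes
    at [s = 0] as survival does. *)
Definition hkernel (s : nat) (t : R) : R :=
  \sum_(j < s) (cos (j%:R * t) + cos (j.+1%:R * t)).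

Lemma continuous_hkernel s : continuous (hkernel s).
Proof.
apply: continuous_big => [|j _ t]; first exact: add_continuous.
by apply: cvgD; exact: continuous_cosM.
Qed.

Lemma hkernel0 t : hkernel 0 t = 0.
Proof. by rewrite /hkernel big_ord0. Qed.

Lemma hkernelS s t :
  hkernel s.+1 t = hkernel s t + (cos (s%:R * t) + cos (s.+1%:R * t)).
Proof. by rewrite /hkernel big_ord_recr. Qed.

Lemma pi_mean_hkernel s : pi_mean (hkernel s) = (0 < s)%:R.
Proof.
elim: s => [|s IH].
  rewrite /pi_mean; under eq_Rintegral do rewrite hkernel0.
  by rewrite Rintegral_cst // mul0r mulr0.
under eq_pi_mean do rewrite hkernelS.
rewrite pi_meanD; last 2 first.
- exact: continuous_hkernel.
- by move=> t; apply: cvgD; exact: continuous_cosM.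
rewrite {}IH pi_meanD ?(pi_mean_cos (ltn0Sn _)); try exact: continuous_cosM.
case: s => [|s]; last by rewrite pi_mean_cos // !addr0.
under eq_pi_mean do rewrite mul0r cos0.
by rewrite pi_mean1 add0r addr0.
Qed.

Lemma cos_natS j (t : R) :
  cos (j.+2%:R * t) + cos (j%:R * t) = 2 * cos t * cos (j.+1%:R * t).
Proof.
have -> : j.+2%:R * t = j.+1%:R * t + t by rewrite -natr1; ring.
have -> : j%:R * t = j.+1%:R * t - t by rewrite -natr1; ring.
by rewrite cosD cosB; ring.
Qed.

Lemma hkernel_rec s t :
  hkernel s.+2 t + hkernel s t = 2 * cos t * hkernel s.+1 t.
Proof.
elim: s => [|s IH].
  rewrite !hkernelS hkernel0.
  have := cos_natS 0 t; rewrite !mul0r cos0 !mul1r => h.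
  have -> : cos (2 * t) = 2 * cos t * cos t - 1 by rewrite -h addrK.
  ring.
rewrite (hkernelS s.+2) (hkernelS s) addrACA IH (hkernelS s.+1) addrACA.
by rewrite !cos_natS -mulrDr -mulrDr.
Qed.

(** Characteristic function of the sum of the first [n] steps of the walk. *)
Definition char_prod p n (t : R) : R :=
  \prod_(1 <= j < n.+1) (1 - 2 * p j * (1 - cos t)).

Lemma continuous_char_prod p n : continuous (char_prod p n).
Proof.
apply: continuous_big => [|j _ t]; first exact: mul_continuous.
apply: cvgB; first exact: cvg_cst.
apply: cvgM; first exact: cvg_cst.
by apply: cvgB; [exact: cvg_cst|exact: continuous_cos].
Qed.

Lemma char_prodS p n t :
  char_prod p n.+1 t = char_prod p n t * (1 - 2 * p n.+1 * (1 - cos t)).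
Proof. by rewrite /char_prod big_nat_recr. Qed.

Lemma survivalE p n s :
  survival p n s = pi_mean (fun t => hkernel s t * char_prod p n t).
Proof.
elim: n s => [|n IH] s.
  under eq_pi_mean do rewrite /char_prod big_geq // mulr1.
  by rewrite pi_mean_hkernel; case: s.
have cKP s' : continuous (fun t => hkernel s' t * char_prod p n t).
  by move=> t; apply: cvgM; [exact: continuous_hkernel|exact: continuous_char_prod].
case: s => [|s] /=.
  under eq_pi_mean do rewrite hkernel0 mul0r.
  by rewrite /pi_mean Rintegral_cst // mul0r mulr0.
rewrite !IH -!pi_meanZ // -!pi_meanD.
- apply: eq_pi_mean => t.
  rewrite char_prodS.
  have := hkernel_rec s t.
  set a := hkernel s.+2 t; set b := hkernel s t.
  move=> h; have -> : a = 2 * cos t * hkernel s.+1 t - b by rewrite -h addrK.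
  ring.
all: move=> t; repeat (apply: cvgD); apply: cvgM; (exact: cvg_cst || exact: cKP).
Qed.

End Integral.

(** * The Gaussian bound *)

Section Gauss.
Context {R : realType}.
Notation mu := (@lebesgue_measure R).
Implicit Types (f g : R -> R) (p : nat -> R).

Lemma one_minus_cos (t : R) : 1 - cos t = 2 * sin (t / 2) ^+ 2.
Proof.
have {1}-> : t = (t / 2) *+ 2 by rewrite -mulr_natr divfK.
by rewrite cos_mulr2n sin2cos2; ring.
Qed.

Lemma one_plus_cos (t : R) : 1 + cos t = 2 * cos (t / 2) ^+ 2.
Proof. by have := one_minus_cos t; rewrite sin2cos2 => h; lra. Qed.

Lemma char_prod_le p n t : (forall j, (0 < j)%N -> 0 <= p j <= 1 / 4) ->
  0 <= char_prod p n t
    <= expR (- (2 * (\sum_(1 <= j < n.+1) p j) * (1 - cos t))).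
Proof.
move=> hp; elim: n => [|n /andP[IH0 IH1]].
  by rewrite /char_prod !big_geq // mulr0 mul0r oppr0 expR0 ler01 lexx.
have /andP[p0 p1] := hp n.+1 isT.
have c1 := cos_le1 t; have c2 := cos_geN1 t.
have f0 : 0 <= 1 - 2 * p n.+1 * (1 - cos t) by nra.
rewrite char_prodS mulr_ge0 // big_nat_recr //= (mulrDr 2) (mulrDl (2 * _)).
rewrite opprD expRD.
by rewrite ler_pM // expR_ge1Dx.
Qed.

Lemma gauss_segment_le (b : R) :
  (\int[mu]_(u in `[0%R, b]) (gauss_fun u)%:E <= (Num.sqrt pi / 2)%:E)%E.
Proof.
rewrite -integral0y_gauss; apply: ge0_subset_integral => //=.
- by apply/measurable_EFinP/measurable_funTS; exact: measurable_gauss_fun.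
- by move=> u _; rewrite lee_fin gauss_fun_ge0.
- by move=> u /=; rewrite !in_itv /= andbT => /andP[].
Qed.

(** The substitution that turns the exponent 2 r^2 (1 - cos t) into a
    square. *)
Definition half_arc (r t : R) : R := 2 * r * sin (t / 2).

Lemma is_derive_half_arc (r t : R) :
  is_derive t 1 (half_arc r) (r * cos (t / 2)).
Proof.
rewrite /half_arc; apply: is_derive_eq.
by rewrite /GRing.scale /=; field.
Qed.

Lemma continuous_half_arc_deriv (r : R) : continuous (fun t : R => r * cos (t / 2)).
Proof.
move=> t; apply: cvgM; first exact: cvg_cst.
under eq_fun do rewrite mulrC.
by rewrite mulrC; exact: continuous_cosM.
Qed.

Lemma continuous_gauss_half_arc (r : R) :
  continuous (fun t => gauss_fun (half_arc r t)).
Proof.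
move=> t; apply: (@continuous_comp _ _ _ (half_arc r) gauss_fun); last first.
  exact: continuous_gauss_fun.
apply: differentiable_continuous; apply/derivable1_diffP.
by apply: ex_derive; exact: is_derive_half_arc.
Qed.

Lemma integral_gauss_arc (r : R) : 0 < r ->
  \int[mu]_(t in `[0, pi]) (gauss_fun (half_arc r t) * (r * cos (t / 2)))
  <= Num.sqrt pi / 2.
Proof.
move=> r0.
have dF t := is_derive_half_arc r t.
have F'E : derive1 (half_arc r) = fun t => r * cos (t / 2).
  by apply/funext => t; rewrite derive1E derive_val.
have cF : continuous (half_arc r).
  move=> t; apply: differentiable_continuous; apply/derivable1_diffP.
  by apply: ex_derive.
have := @integration_by_substitution_increasing R (half_arc r) gauss_fun 0 pi (pi_ge0 R).
rewrite F'E.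
have h0 : half_arc r 0 = 0 by rewrite /half_arc mul0r sin0 mulr0.
rewrite h0 => Hs.
have -> : \int[mu]_(t in `[0, pi]) (gauss_fun (half_arc r t) * (r * cos (t / 2)))
   = fine (\int[mu]_(t in `[0%R, half_arc r pi]) (gauss_fun t)%:E)%E.
  rewrite Hs //.
  - move=> t u /[!in_itv] /= /andP[t0 tpi] /andP[u0 upi] tu.
    rewrite ltr_pM2l ?mulr_gt0 // ltr_sin ?ltr_pM2r ?invr_gt0 // in_itv /=;
      by have := pi_gt0 R; move=> ?; apply/andP; split; lra.
  - by move=> t _; exact: continuous_half_arc_deriv.
  - apply/cvg_ex; eexists; apply: cvg_at_right_filter.
    exact: continuous_half_arc_deriv.
  - apply/cvg_ex; eexists; apply: cvg_at_left_filter.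
    exact: continuous_half_arc_deriv.
  - split => [t _||]; first exact: ex_derive.
    + by apply: cvg_at_right_filter; exact: cF.
    + by apply: cvg_at_left_filter; exact: cF.
  - by apply: continuous_subspaceT => u; exact: continuous_gauss_fun.
rewrite -lee_fin fineK; first exact: gauss_segment_le.
apply: integrable_fin_num => //.
apply: continuous_compact_integrable; first exact: segment_compact.
by apply: continuous_subspaceT => u; exact: continuous_gauss_fun.
Qed.

Lemma survival_le p n : (forall j, (0 < j)%N -> 0 <= p j <= 1 / 4) ->
  0 < \sum_(1 <= j < n.+1) p j ->
  survival p n 1 <= 1 / Num.sqrt (pi * \sum_(1 <= j < n.+1) p j).
Proof.
move=> hp; set S := \sum_(_ <= _ < _) _ => S0.
pose r := Num.sqrt S; have r0 : 0 < r by rewrite sqrtr_gt0.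
have rS : r ^+ 2 = S by rewrite sqr_sqrtr // ltW.
pose h (t : R) := gauss_fun (half_arc r t) * (r * cos (t / 2)).
have ch : continuous h.
  move=> t; apply: cvgM; first exact: continuous_gauss_half_arc.
  exact: continuous_half_arc_deriv.
rewrite survivalE (@le_trans _ _ (pi_mean (fun t => 2 / r * h t))) //.
  apply: le_pi_mean.
  - by move=> t; apply: cvgM; [exact: continuous_hkernel|exact: continuous_char_prod].
  - by move=> t; apply: cvgM; [exact: cvg_cst|exact: ch].
  move=> t /andP[t0 tpi].
  have c0 : 0 <= cos (t / 2).
    by apply: cos_ge0_pihalf; have := pi_ge0 R; move=> ?; apply/andP; split; lra.
  have c1 := cos_le1 (t / 2).
  rewrite hkernelS hkernel0 mul0r mul1r cos0 add0r one_plus_cos.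
  have /andP[P0] := char_prod_le n t hp; rewrite -/S one_minus_cos => P1.
  have -> : 2 / r * h t = 2 * cos (t / 2) * gauss_fun (half_arc r t).
    by rewrite /h; field; rewrite gt_eqF.
  have -> : gauss_fun (half_arc r t) = expR (- (2 * S * (2 * sin (t / 2) ^+ 2))).
    by rewrite /gauss_fun /half_arc -rS; congr expR; ring.
  rewrite ler_pM //; first by rewrite mulr_ge0 // sqr_ge0.
  by rewrite ler_pM2l // expr2 ler_piMl.
rewrite pi_meanZ // /pi_mean sqrtrM ?pi_ge0 // -/r.
have pi0 := pi_gt0 R; have sp0 : 0 < Num.sqrt pi :> R by rewrite sqrtr_gt0.
have -> : 1 / (Num.sqrt pi * r) = 2 / r * (pi^-1 * (Num.sqrt pi / 2)) :> R.
  rewrite -[in X in _ * (X^-1 * _)](sqr_sqrtr (ltW pi0)); field.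
  by rewrite !gt_eqF.
apply: ler_wpM2l; first by rewrite divr_ge0 // ltW.
apply: ler_wpM2l; first by rewrite invr_ge0 ltW.
exact: integral_gauss_arc.
Qed.
End Gauss.

(** * The rate function and passage to the limit *)

Section Sigma.
Context {R : realType}.

Lemma sigma_bounds (y : R) : 0 <= sigma y <= 1.
Proof.
rewrite /sigma; case: eqP => _; first by rewrite ler01 lexx.
by rewrite le_min ler01 divr_ge0 ?sqrtr_ge0 //= ge_min lexx.
Qed.

Lemma survival_le_sigma (p : nat -> R) n :
  (forall j, (0 < j)%N -> 0 <= p j <= 1 / 4) ->
  survival p n 1 <= sigma (\sum_(1 <= j < n.+1) p j).
Proof.
move=> hp; have /andP[_ s1] := survival_bounds hp n 1.
rewrite /sigma; case: eqVneq => // S0; rewrite le_min s1 /=.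
apply: survival_le => //; rewrite lt_neqAle eq_sym S0 /=.
by rewrite big_nat_cond sumr_ge0 // => j; rewrite andbT => /andP[/hp/andP[]].
Qed.

(** Survival after [i] sees only the increment of [tau] from [i] on. *)
Lemma tau_shift (alpha : nat -> R) i n : (i <= n)%N ->
  \sum_(1 <= j < (n - i).+1) step_prob (shift_seq alpha i) j
  = tau alpha n - tau alpha i.
Proof.
move=> i_n; rewrite /tau (big_cat_nat (n := i.+1) (p := n.+1)) //= addrAC subrr add0r.
rewrite -[in RHS](add1n i) big_addn subSn //.
by apply: eq_bigr => j _; rewrite /step_prob /shift_seq addnC.
Qed.

Lemma sigma_cvgy : sigma y @[y --> +oo] --> (0 : R).
Proof.
apply/cvgr0Pnorm_lt => eps eps0; near=> y.
have y0 : 0 < y by near: y; apply: nbhs_pinfty_gt; exact: num_real.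
have big_y : eps^-1 ^+ 2 / pi < y by near: y; apply: nbhs_pinfty_gt; exact: num_real.
have /andP[s0 _] := sigma_bounds y; rewrite ger0_norm // /sigma gt_eqF //.
have pi0 := pi_gt0 R; rewrite ltr_pdivrMr // mulrC in big_y.
rewrite gt_min; apply/orP; right.
rewrite div1r -[ltRHS]invrK ltf_pV2 ?posrE ?invr_gt0 ?sqrtr_gt0 ?mulr_gt0 //.
rewrite -[ltLHS]gtr0_norm ?invr_gt0 // -sqrtr_sqr ltr_sqrt ?mulr_gt0 //.
Unshelve. all: by end_near.
Qed.

(** Dominated convergence for series, with weights [s n i] between 0 and 1. *)
Lemma tannery (c : nat -> R) (s : nat -> nat -> R) :
  (forall i, (1 <= i)%N -> 0 <= c i) ->
  (forall n i, 0 <= s n i <= 1) ->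
  (\sum_(1 <= k <oo) (c k)%:E < +oo)%E ->
  (forall i, s n i @[n --> \oo] --> 0) ->
  \sum_(1 <= i < n.+1) c i * s n i @[n --> \oo] --> 0.
Proof.
move=> c0 s01 c_fin s0.
pose S n := \sum_(1 <= i < n.+1) c i.
have S_le m n : (m <= n)%N -> S m <= S n.
  move=> mn; rewrite /S [leRHS](big_cat_nat (n := m.+1)) //= lerDl.
  rewrite big_nat_cond sumr_ge0 // => i; rewrite andbT => /andP[mi _].
  by apply: c0; exact: leq_trans mi.
have S_cvg : cvgn S.
  apply: nondecreasing_is_cvgn; first by move=> m n; exact: S_le.
  exists (fine (\sum_(1 <= k <oo) (c k)%:E)%E) => _ [n _ <-].
  have le_lim : ((S n)%:E <= \sum_(1 <= k <oo) (c k)%:E)%E.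
    rewrite /S -sumEFin; apply: nneseries_lim_ge => i i1 _.
    by rewrite lee_fin c0.
  rewrite -lee_fin fineK // fin_real // c_fin andbT.
  by rewrite (lt_le_trans _ le_lim) // ltNyr.
have S_lim n : S n <= limn S by apply: nondecreasing_cvgn_le => // ? ?; exact: S_le.
apply/cvgr0Pnorm_lt => eps eps0.
have eps2 : 0 < eps / 2 by rewrite divr_gt0.
(* Beyond N the total mass of c is below eps / 2; the head up to N is a finite
   sum of null sequences. *)
have [N _ tailN] : \forall n \near \oo, `|limn S - S n| < eps / 2.
  by move/pseudometric_normed_Zmodule.cvgr_dist_lt : S_cvg; apply.
have {}tailN : limn S - S N < eps / 2.
  by apply: le_lt_trans (tailN N (leqnn N)); exact: ler_norm.
have head0 : \sum_(1 <= i < N.+1) c i * s n i @[n --> \oo] --> 0.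
  rewrite [X in _ --> X](_ : 0 = \sum_(1 <= i < N.+1) c i * 0); last first.
    by rewrite big1 // => i _; rewrite mulr0.
  apply: cvg_big => [|i _]; first exact: add_continuous.
  by apply: cvgM; [exact: cvg_cst|exact: s0].
have {}head0 : \forall n \near \oo,
    `|\sum_(1 <= i < N.+1) c i * s n i| < eps / 2.
  by move/cvgr0_norm_lt : head0; apply.
near=> n.
have Nn : (N <= n)%N by near: n; exact: nbhs_infty_ge.
have head_n : `|\sum_(1 <= i < N.+1) c i * s n i| < eps / 2.
  by near: n.
rewrite (big_cat_nat (n := N.+1)) //= (le_lt_trans (ler_normD _ _)) //.
rewrite [ltRHS]splitr ltrD // (le_lt_trans _ tailN) //.
apply: (@le_trans _ _ (S n - S N)); last by rewrite lerD2r.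
rewrite /S (big_cat_nat (m := 1) (n := N.+1) (p := n.+1)) //= addrAC subrr add0r.
have c_ge0 i : (N < i)%N -> 0 <= c i by move=> Ni; apply: c0; exact: leq_trans Ni.
rewrite ger0_norm.
  apply: ler_sum_nat => i /andP[/c_ge0 ci _].
  by have /andP[_ s1] := s01 n i; rewrite ler_piMr.
rewrite big_nat_cond sumr_ge0 // => i; rewrite andbT => /andP[/c_ge0 ci _].
by have /andP[s1 _] := s01 n i; rewrite mulr_ge0.
Unshelve. all: by end_near.
Qed.

End Sigma.

Theorem theorem1p1 (R : realType) (X : completeNormedModType R) (C : set X)
    (C_closed : closed C) (C_convex : convex_set C)
    (T : {fun C >-> C}) (T_nonexpansive : 1.-lipschitz_C T)
    (alpha : nat -> R) (e : nat -> X) (epsilon : nat -> R)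
    (alpha_range : forall n : nat, (1 <= n)%N -> 0 <= alpha n <= 1)
    (e_le : forall n : nat, (1 <= n)%N -> `|e n| <= epsilon n)
    (x : nat -> X) (x0_C : C (x 0%N))
    (x_rec : forall n : nat,
      x n.+1 = (1 - alpha n.+1) *: x n + alpha n.+1 *: (T (x n) + e n.+1))
    (kappa : R) (kappa_ge0 : 0 <= kappa)
    (x_C : forall n : nat, C (x n))
    (Tx_bound : forall n : nat, `|T (x n) - x 0%N| <= kappa) :
  (forall n : nat,
     `|x n - T (x n)| <=
       kappa * sigma (tau alpha n)
       + \sum_(1 <= i < n.+1)
           2 * alpha i * epsilon i * sigma (tau alpha n - tau alpha i)
       + 2 * epsilon n.+1)
  /\
  (tau alpha n @[n --> \oo] --> +oo ->
   epsilon n @[n --> \oo] --> (0 : R) ->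
   (\sum_(1 <= k <oo) (alpha k * epsilon k)%:E < +oo)%E ->
   `|x n - T (x n)| @[n --> \oo] --> (0 : R)).
Proof.
have T_nonexp u v : C u -> C v -> `|T u - T v| <= `|u - v|.
  move=> Cu Cv; have := T_nonexpansive (u, v) (conj Cu Cv).
  by rewrite /= mul1r.
have eps_ge0 n : (1 <= n)%N -> 0 <= epsilon n.
  by move=> n1; exact: le_trans (e_le _ n1).
have bound n : `|x n - T (x n)| <=
       kappa * sigma (tau alpha n)
       + \sum_(1 <= i < n.+1)
           2 * alpha i * epsilon i * sigma (tau alpha n - tau alpha i)
       + 2 * epsilon n.+1.
  (* The pursuit bound holds without the nonnegative last term. *)
  rewrite -[leLHS]addr0 lerD ?mulr_ge0 ?eps_ge0 //.
  apply: le_trans (km_residual_bound T_nonexp alpha_range e_le x_rec kappa_ge0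
    x_C Tx_bound n) _.
  apply: lerD.
    by rewrite ler_wpM2l //; apply: survival_le_sigma; exact: step_prob_range.
  apply: ler_sum_nat => i /andP[i1]; rewrite ltnS => i_n.
  apply: ler_wpM2l.
    have /andP[a0 _] := alpha_range _ i1.
    by rewrite !mulr_ge0 ?eps_ge0.
  rewrite -tau_shift //; apply: survival_le_sigma; apply: step_prob_range.
  exact: shift_seq_range.
split=> // tau_oo eps0 sum_fin.
apply: (@squeeze_cvgr _ _ _ _ (fun=> 0) (fun n => kappa * sigma (tau alpha n)
       + \sum_(1 <= i < n.+1)
           2 * alpha i * epsilon i * sigma (tau alpha n - tau alpha i)
       + 2 * epsilon n.+1)).
- by near=> n; rewrite normr_ge0 bound.
- exact: cvg_cst.
rewrite [X in _ --> X](_ : 0 = kappa * 0 + 2 * 0 + 2 * 0 :> R); last first.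
  by rewrite !mulr0 !addr0.
apply: cvgD; first apply: cvgD.
- apply: cvgM; first exact: cvg_cst.
  exact: (cvg_comp _ _ tau_oo sigma_cvgy).
- rewrite (_ : (fun n => \sum_(1 <= i < n.+1)
        2 * alpha i * epsilon i * sigma (tau alpha n - tau alpha i)) = fun n => 2 *
      \sum_(1 <= i < n.+1)
        alpha i * epsilon i * sigma (tau alpha n - tau alpha i)); last first.
    by apply/funext => n; rewrite mulr_sumr; apply: eq_bigr => i _; rewrite !mulrA.
  apply: cvgM; first exact: cvg_cst.
  apply: tannery => //.
  + move=> i i1; have /andP[a0 _] := alpha_range _ i1.
    by rewrite mulr_ge0 ?eps_ge0.
  + by move=> n i; exact: sigma_bounds.
  + move=> i; have shifted_oo : tau alpha n - tau alpha i @[n --> \oo] --> +oo.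
      apply/cvgryPge => A; move/cvgryPge : tau_oo => /(_ (A + tau alpha i)).
      by under eq_near do rewrite -lerBrDr.
    exact: (cvg_comp _ _ shifted_oo sigma_cvgy).
- apply: cvgM; first exact: cvg_cst.
  by rewrite (cvg_shiftS epsilon).
Unshelve. all: by end_near.
Qed.
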